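(* $\mathbf{MIL}\subseteq\mathbf{MIN}$: every formula of $\mathcal{L}$ valid on all posets under the supremum semantics is valid on all posets under the minimal-upper-bound semantics.
   Context: The language $\mathcal{L}$ is given by $\varphi::=\bot\mid p\mid\neg\varphi\mid\varphi\lor\varphi\mid\Diamond\varphi\varphi$, with $p$ ranging over propositional letters and $\Diamond$ a binary modality. A poset model is $(P,\leq,V)$ with $(P,\leq)$ a partial order and $V$ a valuation. For $s,t,u\in P$: $s\in\mathrm{mub}\{t,u\}$ iff $s$ is an upper bound of $\{t,u\}$ and no upper bound $x$ of $\{t,u\}$ satisfies $x<s$; $s=\sup\{t,u\}$ iff $s$ is an upper bound of $\{t,u\}$ below every upper bound of $\{t,u\}$. Booleans are classical. Minimal-upper-bound semantics: $s\Vdash_M\Diamond\varphi\psi$ iff there are $t,u$ with $t\Vdash_M\varphi$, $u\Vdash_M\psi$, $s\in\mathrm{mub}\{t,u\}$. Supremum semantics: $s\Vdash_S\Diamond\varphi\psi$ iff there are $t,u$ with $t\Vdash_S\varphi$, $u\Vdash_S\psi$, $s=\sup\{t,u\}$. $\mathbf{MIN}$ (resp. $\mathbf{MIL}$) is the set of formulas valid (true at every point under every valuation) on every poset under $\Vdash_M$ (resp. $\Vdash_S$). *)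

(* Defs.v *)
From Stdlib Require Export Relation_Definitions.

Inductive formula (Letter : Type) : Type :=
| Bot : formula Letter
| Var : Letter -> formula Letter
| Neg : formula Letter -> formula Letter
| Or : formula Letter -> formula Letter -> formula Letter
| Dia : formula Letter -> formula Letter -> formula Letter.

Arguments Bot {Letter}.
Arguments Var {Letter} _.
Arguments Neg {Letter} _.
Arguments Or {Letter} _ _.
Arguments Dia {Letter} _ _.

Record poset : Type := Poset {
  carrier :> Type;
  le : relation carrier;
  le_order : order carrier le
}.

Arguments le {_} _ _.
Arguments le_order _ : clear implicits.

Definition lt {P : poset} (x y : P) : Prop := le x y /\ x <> y.

Definition upper_bound {P : poset} (s t u : P) : Prop := le t s /\ le u s.

Definition is_mub {P : poset} (s t u : P) : Prop :=
  upper_bound s t u /\ ~ (exists x : P, upper_bound x t u /\ lt x s).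

Definition is_sup {P : poset} (s t u : P) : Prop :=
  upper_bound s t u /\ (forall x : P, upper_bound x t u -> le s x).

(* The clauses shared by the two semantics: [R s t u] is the ternary relation
   interpreting the diamond, [s] being the point of evaluation.  The Boolean
   clauses are read in [Prop], hence are classical only under excluded middle. *)
Fixpoint forces {Letter W : Type} (R : W -> W -> W -> Prop)
    (V : Letter -> W -> Prop) (s : W) (phi : formula Letter) : Prop :=
  match phi with
  | Bot => False
  | Var p => V p s
  | Neg a => ~ forces R V s a
  | Or a b => forces R V s a \/ forces R V s b
  | Dia a b => exists t u : W, forces R V t a /\ forces R V u b /\ R s t u
  end.

Definition forcesM {Letter : Type} (P : poset) (V : Letter -> P -> Prop)
    (s : P) (phi : formula Letter) : Prop :=
  forces (@is_mub P) V s phi.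

Definition forcesS {Letter : Type} (P : poset) (V : Letter -> P -> Prop)
    (s : P) (phi : formula Letter) : Prop :=
  forces (@is_sup P) V s phi.

Definition MIN {Letter : Type} (phi : formula Letter) : Prop :=
  forall (P : poset) (V : Letter -> P -> Prop) (s : P), forcesM P V s phi.

Definition MIL {Letter : Type} (phi : formula Letter) : Prop :=
  forall (P : poset) (V : Letter -> P -> Prop) (s : P), forcesS P V s phi.

(* Main.v *)
(** Every model under the minimal-upper-bound semantics is unravelled into a
    bisimilar model under the supremum semantics.  A point of the unravelling is
    a finite path together with a colour; a step of a path from a point [s]
    goes to one side of a pair [(t, u)] with [s] in mub{t, u}.  In a plain tree
    of paths any two incomparable points would have a supremum, so each path is
    given many coloured copies, which form an antichain: a path [a] extending
    [w] lies below the copy of [w] it was started from, and below every copy of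
    [w] whose colour agrees with one of the steps leading from [w] to [a].  The
    two sides of a pair agree with no common colour, hence their supremum is the
    copy they were started from; two other incomparable extensions of [w] have
    at least two common upper bounds among the copies of [w], hence no supremum
    there. *)

From Stdlib Require Import Classical List Lia.
Require Import Defs.
Import ListNotations.

Section Unravelling.

Context (P : poset) (root : P).

(** A colour chooses a side for every depth and pair: left where it holds, right elsewhere. Indexing
    by depth makes the choices for steps at different depths independent. *)
Definition colour : Type := nat * (P * P) -> Prop.

Record step : Type := Step { origin : colour; pair : P * P; left_side : bool }.

Definition target (s : step) : P :=
  if left_side s then fst (pair s) else snd (pair s).

(* Paths list the most recent step first. *)
Definition label (a : list step) : P :=
  match a with [] => root | s :: _ => target s end.

Fixpoint valid (a : list step) : Prop :=
  match a with
  | [] => True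
  | s :: w => valid w /\ is_mub (label w) (fst (pair s)) (snd (pair s))
  end.

Definition agrees (c : colour) (depth : nat) (s : step) : Prop :=
  c (depth, pair s) <-> left_side s = true.

Inductive under (w : list step) (c : colour) : list step -> Prop :=
| under_origin (e : P * P) (j : bool) : under w c (Step c e j :: w)
| under_agrees (s : step) (l : list step) :
    agrees c (length (l ++ w)) s -> under w c (s :: l ++ w)
| under_cons (s : step) (a : list step) : under w c a -> under w c (s :: a).

Definition point : Type := (list step * colour)%type.

(* Validity of the lower point keeps invalid paths from lying below valid ones. *)
Definition point_le (x y : point) : Prop :=
  x = y \/ valid (fst x) /\ under (fst y) (snd y) (fst x).

Lemma under_split (w : list step) (c : colour) (a : list step) :
  under w c a -> exists l s, a = l ++ s :: w.
Proof.
  induction 1 as [e j | s l _ | s a _ [l [s' ->]]].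
  - now exists [], (Step c e j).
  - destruct (exists_last (l := s :: l) ltac:(discriminate)) as [l' [s' E]].
    exists l', s'. change (s :: l ++ w) with ((s :: l) ++ w).
    now rewrite E, <- app_assoc.
  - now exists (s :: l), s'.
Qed.

Lemma under_length (w : list step) (c : colour) (a : list step) :
  under w c a -> length w < length a.
Proof.
  intros [l [s ->]]%under_split. rewrite length_app; simpl; lia.
Qed.

Lemma under_inv (v : list step) (d : colour) (s : step) (w : list step) :
  under v d (s :: w) ->
  (v = w /\ d = origin s) \/ agrees d (length w) s \/ under v d w.
Proof. inversion 1; subst; auto. Qed.

Lemma under_app (w : list step) (c : colour) (l a : list step) :
  under w c a -> under w c (l ++ a).
Proof. intros H; induction l; simpl; auto using under_cons. Qed.

(** Lying under a copy of [v] passes from a path to all its extensions, and [a] extends [w]. *)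
Lemma under_trans (v : list step) (d : colour) (w : list step) (c : colour)
    (a : list step) :
  under w c a -> under v d w -> under v d a.
Proof.
  intros [l [s ->]]%under_split H. now apply under_app, under_cons.
Qed.

Lemma valid_label_le (l w : list step) :
  valid (l ++ w) -> valid w /\ le (label (l ++ w)) (label w).
Proof.
  destruct (le_order P) as [refl trans _].
  induction l as [| s l IH]; simpl.
  - intros H; split; [exact H | apply refl].
  - intros [H [[Ht Hu] _]]. destruct (IH H) as [Hw Hl]. split; [exact Hw |].
    apply (trans _ (label (l ++ w))); [| exact Hl].
    unfold target. now destruct (left_side s).
Qed.

Lemma point_le_order : order point point_le.
Proof.
  split.
  - intros x; now left.
  - intros x y z [-> | [Vx Hxy]] [<- | [Vy Hyz]].
    + now left.
    + now right.
    + now right.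
    + right; split; [exact Vx | exact (under_trans _ _ _ _ _ Hxy Hyz)].
  - intros x y [-> | [_ Hxy]] [E | [_ Hyx]]; try easy.
    apply under_length in Hxy, Hyx; lia.
Qed.

Definition unravelling : poset := Poset point point_le point_le_order.

Lemma point_le_label (x y : point) :
  valid (fst y) -> point_le x y ->
  valid (fst x) /\ le (label (fst x)) (label (fst y)).
Proof.
  intros Vy [-> | [Vx Hxy]].
  - split; [exact Vy | apply (le_order P)].
  - split; [exact Vx |].
    destruct (under_split _ _ _ Hxy) as [l [s E]].
    rewrite E in Vx |- *.
    change (s :: fst y) with ([s] ++ fst y) in Vx |- *.
    rewrite app_assoc in Vx |- *. now apply valid_label_le.
Qed.

Lemma is_mub_above (s t : P) : le t s -> is_mub s s t.
Proof.
  destruct (le_order P) as [refl _ antisym].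
  intros H; split; [now split |].
  intros [x [[Hx _] [Hxs N]]]. apply N. now apply antisym.
Qed.

Lemma is_mub_sym (P' : poset) (s t u : P') : is_mub s t u -> is_mub s u t.
Proof.
  intros [[Ht Hu] H]; split; [now split |].
  intros [x [[Hu' Ht'] Hx]]. apply H. exists x. now split.
Qed.

(** The demands at [p] and [q] are compatible, and a third index, [fresh], stays free: its two
    possible values give the two colours. *)
Lemma two_colours (p q : nat * (P * P)) (i j : bool) :
  (p = q -> i = j) ->
  exists c d : colour, ((c p <-> i = true) /\ (c q <-> j = true)) /\
    ((d p <-> i = true) /\ (d q <-> j = true)) /\ c <> d.
Proof.
  intros H.
  set (fresh := (S (fst p + fst q), snd p)).
  assert (Fp : p <> fresh) by (intros E; apply (f_equal fst) in E; simpl in E; lia).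
  assert (Fq : q <> fresh) by (intros E; apply (f_equal fst) in E; simpl in E; lia).
  set (c := fun (b : bool) r =>
    r = p /\ i = true \/ r = q /\ j = true \/ r = fresh /\ b = true).
  assert (C : forall b, (c b p <-> i = true) /\ (c b q <-> j = true)).
  { intros b; unfold c; split; (split; [| now auto]).
    - intros [[_ E] | [[E Ej] | [E _]]]; [easy | rewrite (H E); easy | easy].
    - intros [[E Ei] | [[_ E] | [E _]]]; [| easy | easy].
      now rewrite <- (H (eq_sym E)). }
  exists (c true), (c false). split; [apply C | split; [apply C |]].
  intros E. assert (F : c false fresh) by (rewrite <- E; unfold c; auto).
  destruct F as [[F _] | [[F _] | [_ F]]]; [now apply Fp | now apply Fq | easy].
Qed.

(** Unless [s] and [s'] take opposite sides of one pair at one depth, two distinct colours agree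
    with both, so both paths lie under two copies of [w]. *)
Lemma no_common_agreement (w a b l1 l2 l1' l2' : list step) (s s' : step)
    (c : colour) :
  a = l1 ++ s :: l2 ++ w -> b = l1' ++ s' :: l2' ++ w ->
  (forall d : colour, under w d a -> under w d b -> d = c) ->
  length l2 = length l2' /\ pair s = pair s' /\ left_side s <> left_side s'.
Proof.
  intros -> -> U.
  set (p := (length (l2 ++ w), pair s)).
  set (q := (length (l2' ++ w), pair s')).
  destruct (classic (p = q -> left_side s = left_side s')) as [H | H].
  - exfalso.
    destruct (two_colours _ _ _ _ H) as [d1 [d2 [[A1 B1] [[A2 B2] N]]]].
    apply N. rewrite (U d1), (U d2); [easy | | | |];
      now apply under_app, under_agrees.
  - apply imply_to_and in H as [E N].
    split; [| split; [exact (f_equal snd E) | exact N]].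
    apply (f_equal fst) in E; simpl in E. rewrite !length_app in E. lia.
Qed.

Lemma is_sup_label (x y z : unravelling) :
  valid (fst x) -> is_sup x y z ->
  is_mub (label (fst x)) (label (fst y)) (label (fst z)).
Proof.
  destruct x as [w c], y as [a ca], z as [b cb]; simpl.
  intros Vw [[Hy Hz] least].
  pose proof (point_le_label (a, ca) (w, c) Vw Hy) as [_ Ly].
  pose proof (point_le_label (b, cb) (w, c) Vw Hz) as [_ Lz].
  simpl in Ly, Lz.
  destruct Hy as [[= -> _] | [Va Ha]]; [now apply is_mub_above |].
  destruct Hz as [[= -> _] | [Vb Hb]];
    [now apply is_mub_sym, is_mub_above |].
  simpl in *.
  (* Distinct copies of [w] are incomparable, so the least upper bound [(w, c)] is the only copy
     above both paths. *)
  assert (U : forall d : colour, under w d a -> under w d b -> d = c).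
  { intros d Hda Hdb.
    destruct (least (w, d)) as [[= E] | [_ H]]; [now split; right | easy |].
    apply under_length in H; simpl in H; lia. }
  destruct (under_split _ _ _ Ha) as [l [s Ea]].
  destruct (under_split _ _ _ Hb) as [l' [s' Eb]].
  (* Steps at different depths always agree with common colours, so both paths
     extend [w] by a single step. *)
  destruct (no_common_agreement w a b l [] l' [] s s' c Ea Eb U) as [_ [E N]].
  destruct l as [| s1 l].
  2: { destruct (exists_last (l := s1 :: l) ltac:(discriminate)) as [m [r Em]].
       rewrite Em, <- app_assoc in Ea.
       now destruct (no_common_agreement w a b m [s] l' [] r s' c Ea Eb U). }
  destruct l' as [| s1 l'].
  2: { destruct (exists_last (l := s1 :: l') ltac:(discriminate)) as [m [r Em]].
       rewrite Em, <- app_assoc in Eb.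
       now destruct (no_common_agreement w a b [] [] m [s'] s r c Ea Eb U). }
  simpl in Ea, Eb; subst a b; simpl in *.
  (* Validity of the one-step path is the required fact, up to the order of the sides. *)
  destruct Va as [_ M].
  unfold target. rewrite <- E.
  destruct (left_side s), (left_side s'); try easy.
  now apply is_mub_sym.
Qed.

(** No colour agrees with both sides of a pair at one depth. So a common upper bound is either the
    origin [(w, c)] or already above [w] with every colour. *)
Lemma is_sup_sides (w : list step) (c : colour) (t u : P) :
  valid w -> is_mub (label w) t u ->
  @is_sup unravelling (w, c) (Step c (t, u) true :: w, c)
    (Step c (t, u) false :: w, c).
Proof.
  intros V M. split.
  - split; right; (split; [now split | apply under_origin]).
  - intros [v d] [[E | [_ H1]] [E' | [_ H2]]]; simpl in *.
    + congruence.
    + injection E as <- <-. apply under_length in H2; simpl in H2; lia.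
    + injection E' as <- <-. apply under_length in H1; simpl in H1; lia.
    + apply under_inv in H1 as [[-> ->] | [A1 | B1]]; [now left | | now right].
      apply under_inv in H2 as [[-> ->] | [A2 | B2]]; [now left | | now right].
      unfold agrees in A1, A2; simpl in A1, A2.
      exfalso. assert (F : false = true) by tauto. discriminate F.
Qed.

(** For the diamond, [is_sup_label] projects suprema to minimal upper bounds, and [is_sup_sides]
    lifts them back. *)
Lemma forces_unravelling (Letter : Type) (V : Letter -> P -> Prop)
    (phi : formula Letter) (x : unravelling) :
  valid (fst x) ->
  forcesS unravelling (fun p y => V p (label (fst y))) x phi <->
  forcesM P V (label (fst x)) phi.
Proof.
  unfold forcesS, forcesM. revert x.
  induction phi as [| p | a IHa | a IHa b IHb | a IHa b IHb];
    intros x Vx; simpl.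
  - easy.
  - easy.
  - now rewrite IHa.
  - now rewrite IHa, IHb.
  - split.
    + intros [y [z [Hy [Hz S]]]].
      destruct (point_le_label y x Vx) as [Vy _]; [apply S |].
      destruct (point_le_label z x Vx) as [Vz _]; [apply S |].
      exists (label (fst y)), (label (fst z)).
      rewrite <- IHa, <- IHb by assumption. auto using is_sup_label.
    + intros [t [u [Ht [Hu M]]]]. destruct x as [w c].
      exists (Step c (t, u) true :: w, c), (Step c (t, u) false :: w, c).
      rewrite IHa, IHb by now split. auto using is_sup_sides.
Qed.

End Unravelling.

Theorem theorem2 (Letter : Type) (phi : formula Letter) : MIL phi -> MIN phi.
Proof.
  intros H P V s.
  (* The empty path is valid and labelled [s]; any colour would do. *)
  now apply (forces_unravelling P s Letter V phi ([], fun _ => True)).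
Qed.
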